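(* Let $m,d,n\ge1$, $p,q,\lambda>0$, $g(\alpha)=\|\alpha/\lambda\|_p^q$, and let $\mathfrak{D}$ be the set of matrices in $\mathbb{R}^{m\times d}$ with unit $\ell_2$-norm columns. Let $\mathbb{P}$ be a probability distribution on $\mathbb{R}^m$ with $\mathbb{P}(\|x\|_2\le1)=1$, and let $X=[x_1,\dots,x_n]$ consist of $n$ i.i.d. samples from $\mathbb{P}$. Let $0\le t<\infty$ and $L>\lambda\, d^{(1-1/p)_+}(1/2)^{1/q}$. Set $$\beta=\frac{md}{8}\max\{\log(6\sqrt8\,L),1\},\qquad \eta(n,m,d,L)=2\sqrt{\frac{\beta\log n}{n}}+\sqrt{\frac{\beta+t/\sqrt8}{n}}.$$ Then with probability at least $1-2e^{-t}$, $$\sup_{D\in\mathfrak{D}}\big|F_X(D)-\mathbb{E}_{x\sim\mathbb{P}}f_x(D)\big|\le\eta(n,m,d,L).$$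
   Context: For $x\in\mathbb{R}^m$ and $D\in\mathbb{R}^{m\times d}$, $f_x(D)=\inf_{\alpha\in\mathbb{R}^d}\tfrac12\|x-D\alpha\|_2^2+g(\alpha)$, and $F_X(D)=\frac1n\sum_{i=1}^nf_{x_i}(D)$. $(t)_+=\max\{t,0\}$; $\log$ is the natural logarithm. For $0<p<1$, $\|\cdot\|_p$ is the $\ell_p$ quasi-norm. *)

(* Defs.v *)
From HB Require Import structures.
From mathcomp Require Import all_boot all_order all_algebra.
From mathcomp Require Import all_classical all_reals all_analysis.
Set Implicit Arguments. Unset Strict Implicit. Unset Printing Implicit Defensive.
Import Order.TTheory GRing.Theory Num.Theory.
Local Open Scope ring_scope.
Local Open Scope classical_set_scope.

Definition l2norm (R : realType) (k : nat) (v : 'cV[R]_k) : R :=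
  Num.sqrt (\sum_(i < k) v i 0 ^+ 2).

Definition lpnorm (R : realType) (k : nat) (p : R) (a : 'cV[R]_k) : R :=
  powR (\sum_(i < k) powR `|a i 0| p) p^-1.

Definition greg (R : realType) (k : nat) (p q lam : R) (a : 'cV[R]_k) : R :=
  powR (lpnorm p (lam^-1 *: a)) q.

Definition fx (R : realType) (m d : nat) (p q lam : R)
    (x : 'cV[R]_m) (D : 'M[R]_(m, d)) : R :=
  inf [set v | exists a : 'cV[R]_d,
        v = 2^-1 * l2norm (x - D *m a) ^+ 2 + greg p q lam a].

Definition FX (R : realType) (m d n : nat) (p q lam : R)
    (X : 'I_n -> 'cV[R]_m) (D : 'M[R]_(m, d)) : R :=
  n%:R^-1 * \sum_(i < n) fx p q lam (X i) D.

Arguments l2norm {R k}.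
Definition unit_col_dicts (R : realType) (m d : nat) : set 'M[R]_(m, d) :=
  [set D | forall j : 'I_d, l2norm (col j D) = 1].

Definition random_vector (R : realType) (disp : measure_display)
    (Omega : measurableType disp) (m : nat) (x : Omega -> 'cV[R]_m) : Prop :=
  forall j : 'I_m, measurable_fun setT (fun w => x w j 0).

(* the random vectors x_i (i < n) are mutually independent: product rule on
   all Borel rectangles (a pi-system generating the Borel sigma-algebra of
   R^m) *)
Definition independent_vectors (R : realType) (disp : measure_display)
    (Omega : measurableType disp) (P : probability Omega R) (n m : nat)
    (x : 'I_n -> Omega -> 'cV[R]_m) : Prop :=
  forall B : 'I_n -> 'I_m -> set R,
    (forall i j, measurable (B i j)) ->
    fine (P [set w | forall i j, B i j (x i w j 0)]) =
    \prod_(i < n) fine (P [set w | forall j, B i j (x i w j 0)]).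

(* x and y have the same distribution on R^m (laws agree on Borel
   rectangles, hence on all Borel sets) *)
Definition same_law (R : realType) (disp : measure_display)
    (Omega : measurableType disp) (P : probability Omega R) (m : nat)
    (x y : Omega -> 'cV[R]_m) : Prop :=
  forall B : 'I_m -> set R, (forall j, measurable (B j)) ->
    P [set w | forall j, B j (x w j 0)] = P [set w | forall j, B j (y w j 0)].
Arguments unit_col_dicts {R} m d.

(* Main.v *)
(** A dictionary only matters through the codes [a] that beat the zero code;
    these satisfy [greg a <= 1/2], hence [|a|_1 <= L], so [fx x] moves by at
    most [r + r^2/2] with [r = L * e] when every column of the dictionary
    moves by [e].
    No volumetric covering bound is needed: an entrywise grid with
    [K ~ n * max (6 * sqrt 8 * L, e)] points per entry has [K ^ (m * d)]
    elements, and the term [beta * ln n] of the bound pays both for its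
    cardinality and for its resolution.  The samples are quantised as well:
    the cells are Borel rectangles, so independence and equality in law reduce
    the tail estimate to Hoeffding's inequality and a union bound for a finite
    product distribution, and the quantisation error is absorbed by the slack
    in the constants.  If the claimed bound exceeds 27/50, the values of [fx],
    which lie in [[0, 1/2]] up to the quantisation error, already satisfy it. *)
Require Import Defs.
From HB Require Import structures.
From mathcomp Require Import all_boot all_order all_algebra.
From mathcomp Require Import all_classical all_reals all_analysis.
From mathcomp Require Import measurable_realfun ring lra.
Set Implicit Arguments. Unset Strict Implicit. Unset Printing Implicit Defensive.
Import Order.TTheory GRing.Theory Num.Theory numFieldNormedType.Exports.
Local Open Scope ring_scope.
Local Open Scope classical_set_scope.

(** * Regularity of the sparse coding cost *)

Section l2norm_theory.
Variables (R : realType) (m : nat).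
Implicit Types u v : 'cV[R]_m.

Lemma l2norm_ge0 v : 0 <= l2norm v. Proof. exact: sqrtr_ge0. Qed.

Lemma l2norm_sqr v : l2norm v ^+ 2 = \sum_(i < m) v i 0 ^+ 2.
Proof. by rewrite sqr_sqrtr// sumr_ge0// => i _; exact: sqr_ge0. Qed.

Lemma l2norm_le v r : 0 <= r -> \sum_(i < m) v i 0 ^+ 2 <= r ^+ 2 -> l2norm v <= r.
Proof. by move=> r0; rewrite -l2norm_sqr ler_sqr ?nnegrE ?l2norm_ge0. Qed.

Lemma coord_le_l2norm v i : `|v i 0| <= l2norm v.
Proof.
rewrite -ler_sqr ?nnegrE ?l2norm_ge0// l2norm_sqr -normrX ger0_norm ?sqr_ge0//.
by rewrite (bigD1 i)//= lerDl sumr_ge0// => j _; exact: sqr_ge0.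
Qed.

Lemma l2norm_le_sqrt v e : 0 <= e -> (forall i, `|v i 0| <= e) -> l2norm v <= Num.sqrt m%:R * e.
Proof.
move=> e0 ve.
apply: l2norm_le; first by rewrite mulr_ge0// sqrtr_ge0.
rewrite exprMn sqr_sqrtr// mulr_natl -[m in leRHS]card_ord -sumr_const.
apply: ler_sum => i _.
by rewrite -[v i 0 ^+ 2]ger0_norm ?sqr_ge0// normrX lerXn2r ?nnegrE.
Qed.

Lemma l2norm0 : l2norm (0 : 'cV[R]_m) = 0.
Proof. by rewrite /l2norm big1 ?sqrtr0// => i _; rewrite mxE expr0n. Qed.

Lemma l2norm_eq0 v : l2norm v = 0 -> v = 0.
Proof.
move=> v0; apply/matrixP => i j; rewrite mxE (ord1 j).
by apply/eqP; rewrite -normr_le0 -v0 coord_le_l2norm.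
Qed.

Lemma l2normZ a v : l2norm (a *: v) = `|a| * l2norm v.
Proof.
rewrite /l2norm -sqrtr_sqr -sqrtrM ?sqr_ge0// mulr_sumr; congr Num.sqrt.
by apply: eq_bigr => i _; rewrite mxE exprMn.
Qed.

(** Cauchy-Schwarz: once both vectors are scaled to norm 1, [2 a b <= a^2 + b^2] is summed over the
    coordinates. *)
Lemma dot_le_l2norm u v : \sum_(i < m) u i 0 * v i 0 <= l2norm u * l2norm v.
Proof.
have [u0|u0] := eqVneq (l2norm u) 0.
  by rewrite (l2norm_eq0 u0) l2norm0 mul0r big1// => i _; rewrite mxE mul0r.
have [v0|v0] := eqVneq (l2norm v) 0.
  by rewrite (l2norm_eq0 v0) l2norm0 mulr0 big1// => i _; rewrite mxE mulr0.
have up : 0 < l2norm u by rewrite lt_neqAle eq_sym u0 l2norm_ge0.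
have vp : 0 < l2norm v by rewrite lt_neqAle eq_sym v0 l2norm_ge0.
rewrite -[leRHS]mulr1 -ler_pdivrMl ?mulr_gt0// mulr_sumr.
apply: (@le_trans _ _ (\sum_(i < m) 2^-1 * ((l2norm u) ^- 2 * u i 0 ^+ 2
                                          + (l2norm v) ^- 2 * v i 0 ^+ 2))).
  apply: ler_sum => i _; rewrite -subr_ge0.
  rewrite (_ : _ - _ = 2^-1 * ((l2norm u)^-1 * u i 0 - (l2norm v)^-1 * v i 0) ^+ 2).
    by rewrite mulr_ge0// sqr_ge0.
  by field; rewrite u0 v0.
by rewrite -mulr_sumr big_split/= -!mulr_sumr -!l2norm_sqr !mulVf ?expf_neq0//.
Qed.

Lemma l2normD u v : l2norm (u + v) <= l2norm u + l2norm v.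
Proof.
apply: l2norm_le; first by rewrite addr_ge0 ?l2norm_ge0.
rewrite sqrrD !l2norm_sqr.
rewrite (eq_bigr (fun i => u i 0 ^+ 2 + (u i 0 * v i 0) *+ 2 + v i 0 ^+ 2)); last first.
  by move=> i _; rewrite mxE sqrrD.
rewrite 2!big_split/= sumrMnl lerD2r lerD2l lerMn2r/=.
exact: dot_le_l2norm.
Qed.

Lemma l2normN v : l2norm (- v) = l2norm v.
Proof. by rewrite -scaleN1r l2normZ normrN1 mul1r. Qed.

Lemma l2norm_sum (I : finType) (F : I -> 'cV[R]_m) :
  l2norm (\sum_i F i) <= \sum_i l2norm (F i).
Proof.
elim/big_ind2: _ => [|x1 x2 y1 y2 h1 h2|//]; first by rewrite l2norm0.
by apply: le_trans (l2normD _ _) _; rewrite lerD.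
Qed.

End l2norm_theory.

Lemma l2norm_mulmx (R : realType) (m d : nat) (D : 'M[R]_(m, d)) (a : 'cV[R]_d) e :
  (forall j, l2norm (col j D) <= e) -> l2norm (D *m a) <= (\sum_j `|a j 0|) * e.
Proof.
move=> De.
have -> : D *m a = \sum_j a j 0 *: col j D.
  apply/matrixP => i k; rewrite mxE summxE; apply: eq_bigr => j _.
  by rewrite !mxE (ord1 k) mulrC.
apply: le_trans (l2norm_sum _) _; rewrite mulr_suml; apply: ler_sum => j _.
by rewrite l2normZ ler_wpM2l.
Qed.

(** * Comparison of the l1 norm with the lp (quasi-)norm and the regulariser *)

Lemma powR_div (R : realType) (z s p : R) : 0 <= z -> 0 <= s ->
  (z / s) `^ p = (s `^ p)^-1 * z `^ p.
Proof.
move=> z0 s0; rewrite powRM ?invr_ge0// -(powR_inv1 s0) -powRrM mulN1r powRN.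
by rewrite mulrC.
Qed.

Section lpnorm_theory.
Variables (R : realType) (d : nat).
Implicit Types a : 'cV[R]_d.

Lemma sum_powR_ge0 p a : 0 <= \sum_(i < d) `|a i 0| `^ p.
Proof. by apply: sumr_ge0 => i _; exact: powR_ge0. Qed.

Lemma lpnormK p a : 0 < p -> lpnorm p a `^ p = \sum_(i < d) `|a i 0| `^ p.
Proof.
by move=> p0; rewrite /lpnorm -powRrM mulVf ?gt_eqF// powRr1// sum_powR_ge0.
Qed.

Lemma lpnorm_eq0 p a : 0 < p -> lpnorm p a = 0 -> a = 0.
Proof.
move=> p0 a0; have := lpnormK a p0; rewrite a0 powR0 ?gt_eqF// => /esym/eqP.
rewrite psumr_eq0 => [/allP h|i _]; last exact: powR_ge0.
apply/matrixP => i j; rewrite (ord1 j) mxE.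
have := h i (mem_index_enum _) => /eqP/powR_eq0_eq0/eqP.
by rewrite normr_eq0 => /eqP.
Qed.

(** Young's inequality for the product [z * 1]; equivalently, [z^p] lies above its tangent at 1. *)
Lemma powR_tangent (p z : R) : 1 <= p -> 0 <= z -> z <= z `^ p / p + (1 - p^-1).
Proof.
rewrite le_eqVlt => /predU1P[<-|p1] z0; first by rewrite invr1 subrr addr0 mulr1 powRr1.
have p0 : 0 < p by exact: lt_trans p1.
have q0 : 0 < 1 - p^-1 by rewrite subr_gt0 invf_lt1.
have := @conjugate_powR _ z 1 p (1 - p^-1)^-1 z0 ler01 p0.
by rewrite invr_gt0 q0 invrK powR1 mul1r mulr1 addrC subrK; apply.
Qed.

(** For [p >= 1], tangent bounds at a common scale are summed. For [p < 1], each ratio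
    [|a_j| / |a|_p] is at most 1, hence at most its own [p]-th power, and these powers sum to 1. *)
Lemma l1_le_lpnorm p a : 0 < p ->
  \sum_(j < d) `|a j 0| <= d%:R `^ (Num.max (1 - p^-1) 0) * lpnorm p a.
Proof.
move=> p0; have N0 : 0 <= lpnorm p a by exact: powR_ge0.
have [a0|an0] := eqVneq (lpnorm p a) 0.
  by rewrite a0 mulr0 big1// => j _; rewrite (lpnorm_eq0 p0 a0) mxE normr0.
have Np : 0 < lpnorm p a by rewrite lt_neqAle eq_sym an0.
have [p1|p1] := leP 1 p.
  rewrite max_l; last by rewrite subr_ge0 invf_le1.
  have [d0|d0] := eqVneq d 0%N.
    rewrite big1 ?mulr_ge0 ?powR_ge0// => j _.
    by have := ltn_ord j; rewrite {2}d0.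
  have dp : 0 < d%:R :> R by rewrite ltr0n lt0n.
  (* [S] is the power mean of the [|a_j|]: the powers [(|a_j| / S)^p] sum to [d], so the tangent
     bounds add up to [d / p + d * (1 - 1 / p) = d]. *)
  pose S := d%:R `^ (- p^-1) * lpnorm p a.
  have S0 : 0 < S by rewrite mulr_gt0// powR_gt0.
  have SE : S `^ p = d%:R^-1 * \sum_(i < d) `|a i 0| `^ p.
    rewrite powRM ?powR_ge0// lpnormK// -powRrM mulNr mulVf ?gt_eqF//.
    by rewrite powR_inv1.
  have -> : d%:R `^ (1 - p^-1) * lpnorm p a = d%:R * S.
    rewrite powRD; last by rewrite (gt_eqF dp) implybT.
    by rewrite powRr1// mulrA.
  rewrite -ler_pdivrMr// mulr_suml.
  apply: (@le_trans _ _ (\sum_(j < d) ((S `^ p)^-1 * `|a j 0| `^ p / p + (1 - p^-1)))).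
    apply: ler_sum => j _.
    apply: le_trans (powR_tangent p1 _) _; first by rewrite divr_ge0// ltW.
    by rewrite powR_div// ltW.
  rewrite big_split/= -mulr_suml -mulr_sumr sumr_const card_ord SE.
  have : \sum_(i < d) `|a i 0| `^ p != 0 by rewrite -lpnormK// gt_eqF// powR_gt0.
  move: (\sum_(i < d) _) => T T0; rewrite -mulr_natl le_eqVlt; apply/orP; left.
  by apply/eqP; field; rewrite T0 !gt_eqF.
rewrite max_r; last by rewrite subr_le0 ltW// invf_gt1.
rewrite powRr0 -ler_pdivrMr// mulr_suml.
apply: (@le_trans _ _ (\sum_(j < d) (lpnorm p a `^ p)^-1 * `|a j 0| `^ p)).
  apply: ler_sum => j _.
  have -> : (lpnorm p a `^ p)^-1 * `|a j 0| `^ p = (`|a j 0| / lpnorm p a) `^ p.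
    by rewrite powR_div.
  have [->|aj0] := eqVneq (`|a j 0|) 0; first by rewrite mul0r powR_ge0.
  rewrite -[leLHS]powRr1 ?divr_ge0//; apply: ger_powR; last exact: ltW.
  rewrite divr_gt0//=; last by rewrite lt_neqAle eq_sym aj0 normr_ge0.
  rewrite ler_pdivrMr// mul1r.
  have pn0 : p != 0 by rewrite gt_eqF.
  rewrite -[leLHS]powRr1// -(divff pn0) powRrM /lpnorm.
  apply: ge0_ler_powR; rewrite ?nnegrE ?invr_ge0 ?powR_ge0 ?sum_powR_ge0 ?(ltW p0)//.
  by rewrite (bigD1 j)//= lerDl sumr_ge0// => i _; exact: powR_ge0.
by rewrite -mulr_sumr -lpnormK// mulVf// gt_eqF// powR_gt0.
Qed.

Lemma greg_ge0 p q lam a : 0 <= greg p q lam a.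
Proof. exact: powR_ge0. Qed.

Lemma greg0 p q lam : 0 < p -> 0 < q -> greg p q lam (0 : 'cV[R]_d) = 0.
Proof.
move=> p0 q0; rewrite /greg /lpnorm big1; last first.
  by move=> i _; rewrite scaler0 mxE normr0 powR0// gt_eqF.
by rewrite powR0 ?invr_eq0 ?gt_eqF// powR0 ?gt_eqF.
Qed.

(** Inverts the [q]-th power and the scaling by [lam]; at [b = 1/2] the right-hand side is exactly
    the threshold imposed on [L]. *)
Lemma l1_le_greg p q lam b a : 0 < p -> 0 < q -> 0 < lam -> 0 <= b ->
  greg p q lam a <= b ->
  \sum_(j < d) `|a j 0| <= lam * d%:R `^ (Num.max (1 - p^-1) 0) * b `^ q^-1.
Proof.
move=> p0 q0 l0 b0 gb.
have lpb : lpnorm p (lam^-1 *: a) <= b `^ q^-1.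
  have := ge0_ler_powR (_ : 0 <= q^-1) _ _ gb.
  rewrite /greg -powRrM divff ?gt_eqF// powRr1 ?powR_ge0//; apply.
  - by rewrite invr_ge0 ltW.
  - by rewrite nnegrE greg_ge0.
  - by rewrite nnegrE.
have -> : \sum_(j < d) `|a j 0| = lam * \sum_(j < d) `|(lam^-1 *: a) j 0|.
  rewrite mulr_sumr; apply: eq_bigr => j _.
  by rewrite mxE normrM gtr0_norm ?invr_gt0// mulrA divff ?mul1r// gt_eqF.
rewrite -mulrA ler_pM2l//; apply: le_trans (l1_le_lpnorm _ p0) _.
by rewrite ler_wpM2l ?powR_ge0.
Qed.

End lpnorm_theory.

Section fx_theory.
Variables (R : realType) (m d : nat) (p q lam : R).
Hypotheses (p0 : 0 < p) (q0 : 0 < q) (lam0 : 0 < lam).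
Implicit Types (x : 'cV[R]_m) (D : 'M[R]_(m, d)) (a : 'cV[R]_d).

Let val x D a : R := 2^-1 * l2norm (x - D *m a) ^+ 2 + greg p q lam a.

Let val_ge0 x D a : 0 <= val x D a.
Proof. by rewrite addr_ge0 ?greg_ge0// mulr_ge0// sqr_ge0. Qed.

Lemma fx_le x D a : fx p q lam x D <= 2^-1 * l2norm (x - D *m a) ^+ 2 + greg p q lam a.
Proof.
apply: ge_inf; last by exists a.
by exists 0 => _ [b ->]; exact: val_ge0.
Qed.

Lemma fx_ge x D c :
  (forall a, c <= 2^-1 * l2norm (x - D *m a) ^+ 2 + greg p q lam a) ->
  c <= fx p q lam x D.
Proof.
move=> ca; apply: lb_le_inf; first by exists (val x D 0); exists 0.
by move=> _ [a ->].
Qed.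

Lemma fx_ge0 x D : 0 <= fx p q lam x D.
Proof. by apply: fx_ge => a; exact: val_ge0. Qed.

Lemma fx_le_sqr x D : fx p q lam x D <= 2^-1 * l2norm x ^+ 2.
Proof. by have := fx_le x D 0; rewrite mulmx0 subr0 greg0// addr0. Qed.

Lemma fx_le_half x D : l2norm x <= 1 -> fx p q lam x D <= 2^-1.
Proof.
move=> x1; apply: le_trans (fx_le_sqr x D) _.
by rewrite ler_piMr// expr_le1// l2norm_ge0.
Qed.

(* Only codes [a] beating the zero code need to be compared: for the others
   the bound [fx_le_sqr] at the perturbed point is already good enough. *)
Lemma fx_perturb x x' D D' r : 0 <= r -> l2norm (x' - x) <= r ->
  (forall a, 2^-1 * l2norm (x - D *m a) ^+ 2 + greg p q lam a <= 2^-1 * l2norm x ^+ 2 ->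
     l2norm ((x' - D' *m a) - (x - D *m a)) <= r) ->
  fx p q lam x' D' <= fx p q lam x D + l2norm x * r + r ^+ 2 / 2.
Proof.
move=> r0 x'r ar; rewrite -addrA -lerBlDr; apply: fx_ge => a; rewrite lerBlDr.
have Nx0 := l2norm_ge0 x.
have tri (u v : 'cV[R]_m) : l2norm (v - u) <= r -> l2norm v <= l2norm u + r.
  move=> h; have -> : v = u + (v - u) by rewrite addrC subrK.
  by apply: le_trans (l2normD _ _) _; rewrite lerD2l.
have sq (u v : 'cV[R]_m) : l2norm (v - u) <= r -> l2norm v ^+ 2 <= (l2norm u + r) ^+ 2.
  move=> /tri h; rewrite lerXn2r ?nnegrE ?addr_ge0 ?l2norm_ge0//.
have [va|va] := leP (2^-1 * l2norm (x - D *m a) ^+ 2 + greg p q lam a) (2^-1 * l2norm x ^+ 2).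
  have := sq _ _ (ar _ va).
  have resx : l2norm (x - D *m a) <= l2norm x.
    rewrite -ler_sqr ?nnegrE ?l2norm_ge0//.
    by have := greg_ge0 p q lam a; lra.
  have := ler_wpM2r r0 resx; have := fx_le x' D' a.
  rewrite sqrrD; nra.
have := sq _ _ x'r; have := fx_le_sqr x' D'; rewrite sqrrD; nra.
Qed.

Lemma fx_perturb_x x x' D r : l2norm (x' - x) <= r ->
  fx p q lam x' D <= fx p q lam x D + l2norm x * r + r ^+ 2 / 2.
Proof.
move=> xr; apply: fx_perturb => // [|a _]; first exact: le_trans (l2norm_ge0 _) xr.
by rewrite opprB addrA subrK.
Qed.

(** [x'] may leave the ball, but its norm is at most [1 + r], so the reverse inequality costs
    [(1 + r) * r + r^2 / 2], which is below [3 * r] because [r <= 1]. *)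
Lemma fx_perturb_x_ball x x' D r : l2norm x <= 1 -> l2norm (x' - x) <= r -> r <= 1 ->
  `|fx p q lam x' D - fx p q lam x D| <= 3 * r.
Proof.
move=> x1 xr r1; have r0 : 0 <= r by exact: le_trans (l2norm_ge0 _) xr.
have Nx0 := l2norm_ge0 x; have Nx'0 := l2norm_ge0 x'.
have h1 := fx_perturb_x D xr.
have h2 : fx p q lam x D <= fx p q lam x' D + l2norm x' * r + r ^+ 2 / 2.
  by apply: fx_perturb_x; rewrite -l2normN opprB.
have x'2 : l2norm x' <= 1 + r.
  have -> : x' = x + (x' - x) by rewrite addrC subrK.
  by apply: le_trans (l2normD _ _) _; exact: lerD.
rewrite ler_norml; apply/andP; split; nra.
Qed.

Lemma fx_perturb_dict L e x D D' : l2norm x <= 1 ->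
  lam * d%:R `^ (Num.max (1 - p^-1) 0) * (2^-1) `^ q^-1 <= L ->
  (forall j, l2norm (col j (D' - D)) <= e) -> 0 <= e ->
  fx p q lam x D' <= fx p q lam x D + L * e + (L * e) ^+ 2 / 2.
Proof.
move=> x1 hL De e0.
have L0 : 0 <= L by apply: le_trans hL; rewrite !mulr_ge0 ?powR_ge0 ?ltW.
have Le0 : 0 <= L * e by rewrite mulr_ge0.
apply: (@le_trans _ _ (fx p q lam x D + l2norm x * (L * e) + (L * e) ^+ 2 / 2)).
  apply: fx_perturb => //; first by rewrite subrr l2norm0.
  move=> a va; rewrite opprB addrC addrA subrK -opprB -mulmxBl l2normN.
  apply: le_trans (l2norm_mulmx a De) _; rewrite ler_wpM2r//.
  apply: le_trans hL; apply: l1_le_greg => //.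
  have x2 : l2norm x ^+ 2 <= 1 by rewrite expr_le1// l2norm_ge0.
  have := sqr_ge0 (l2norm (x - D *m a)); lra.
by rewrite lerD2r lerD2l ler_piMl.
Qed.

Lemma fx_perturb_dict_abs L e x D D' : l2norm x <= 1 ->
  lam * d%:R `^ (Num.max (1 - p^-1) 0) * (2^-1) `^ q^-1 <= L ->
  (forall j, l2norm (col j (D' - D)) <= e) -> 0 <= e ->
  `|fx p q lam x D' - fx p q lam x D| <= L * e + (L * e) ^+ 2 / 2.
Proof.
move=> x1 hL De e0; have h1 := fx_perturb_dict x1 hL De e0.
have h2 : fx p q lam x D <= fx p q lam x D' + L * e + (L * e) ^+ 2 / 2.
  apply: fx_perturb_dict => // j; rewrite -opprB.
  have -> : col j (- (D' - D)) = - col j (D' - D) by apply/matrixP => i k; rewrite !mxE.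
  by rewrite l2normN.
rewrite ler_norml; lra.
Qed.

End fx_theory.

(** * Hoeffding's inequality for finite distributions *)

(** Mean value theorem on [[0, u]]; applied twice below, to pass from the sign of a second
    derivative to that of the function. *)
Lemma derive_ge0_ge0_at0 (R : realType) (f df : R -> R) (u : R) :
  (forall z : R, is_derive z 1 f (df z)) -> f 0 = 0 ->
  (forall z, 0 <= z -> 0 <= df z) -> 0 <= u -> 0 <= f u.
Proof.
move=> fd f0 dfge0; rewrite le_eqVlt => /predU1P[<-|u0]; first by rewrite f0.
have [|c] := MVT u0 (fun z _ => fd z).
  apply: continuous_subspaceT => z.
  exact/differentiable_continuous/derivable1_diffP/(@ex_derive _ _ _ _ _ _ _ (fd z)).
rewrite in_itv/= f0 subr0 subr0 => /andP[c0 _] ->.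
by rewrite mulr_ge0 ?dfge0// ltW.
Qed.

(** [h] is the logarithm of the ratio of the two sides, [k] and [dk] its first two derivatives. Both
    [h] and [k] vanish at 0, and [dk = 1/4 - v * (1 - v)] with [v = th * expR z / D z], which is
    nonnegative. *)
Lemma bernoulli_mgf_le_pos (R : realType) (th u : R) : 0 <= th <= 1 -> 0 <= u ->
  1 - th + th * expR u <= expR (th * u + u ^+ 2 / 8).
Proof.
move=> /andP[th0 th1] u0.
pose D z : R := 1 - th + th * expR z.
have D0 z : 0 < D z.
  rewrite /D; have [->|thn0] := eqVneq th 0; first by rewrite subr0 mul0r addr0.
  by rewrite ltr_wpDl ?subr_ge0// mulr_gt0 ?expR_gt0// lt_neqAle eq_sym thn0.
pose k z : R := th + z / 4 - th * expR z / D z.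
pose dk z : R := 4^-1 - th * expR z * (1 - th) / D z ^+ 2.
pose h z : R := th * z + z ^+ 2 / 8 - ln (D z).
have dD (z : R) : is_derive z 1 D (th * expR z).
  rewrite /D; apply: is_derive_eq. by rewrite /GRing.scale/=; ring.
have hk (z : R) : is_derive z 1 h (k z).
  have dl : is_derive z 1 (@ln R \o D) ((D z)^-1 * (th * expR z)).
    by have := is_derive1_ln (D0 z) => H; apply: is_derive1_comp.
  rewrite /h; apply: is_derive_eq. rewrite /GRing.scale/= /k; field; by rewrite lt0r_neq0.
have kdk (z : R) : is_derive z 1 k (dk z).
  have dV : is_derive z 1 (fun z => (D z)^-1) (- (D z) ^- 2 * (th * expR z)).
    exact: (is_deriveV (lt0r_neq0 (D0 z)) (dD z)).
  rewrite /k; apply: is_derive_eq. rewrite /GRing.scale/= /dk.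
  have -> : 1 - th = D z - th * expR z by rewrite /D addrK.
  field.
  by rewrite lt0r_neq0.
have dk0 z : 0 <= dk z.
  rewrite subr_ge0 ler_pdivrMr ?exprn_gt0// -subr_ge0.
  have -> : 4^-1 * D z ^+ 2 - th * expR z * (1 - th) = 4^-1 * (1 - th - th * expR z) ^+ 2.
    by rewrite /D; field.
  by rewrite mulr_ge0// sqr_ge0.
have k0 z : 0 <= z -> 0 <= k z.
  apply: (derive_ge0_ge0_at0 kdk) => [|? _]; last exact: dk0.
  by rewrite /k /D expR0 mulr1 subrK divr1 mul0r addr0 subrr.
have h0 : 0 <= h u.
  apply: (derive_ge0_ge0_at0 hk) => //.
  by rewrite /h /D expR0 mulr1 subrK ln1 mulr0 expr0n/= mul0r addr0 subrr.
move: h0; rewrite /h subr_ge0 -ler_expR lnK//.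
by rewrite posrE.
Qed.

(** A negative [u] is handled by exchanging success and failure, that is [th] with [1 - th] and [u]
    with [- u], and multiplying by [expR u]. *)
Lemma bernoulli_mgf_le (R : realType) (th u : R) : 0 <= th <= 1 ->
  1 - th + th * expR u <= expR (th * u + u ^+ 2 / 8).
Proof.
move=> th01; have [u0|u0] := leP 0 u; first exact: bernoulli_mgf_le_pos.
have th01' : 0 <= 1 - th <= 1 by lra.
have := @bernoulli_mgf_le_pos _ (1 - th) (- u) th01' ltac:(lra).
rewrite -(ler_pM2l (expR_gt0 u)) -expRD; congr (_ <= expR _); last by ring.
rewrite mulrDr mulrCA -expRD addrN expR0; ring.
Qed.

Lemma expR_chord_le (R : realType) (b s z : R) : 0 < b -> 0 <= z <= b ->
  expR (s * z) <= 1 - z / b + z / b * expR (s * b).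
Proof.
move=> b0 /andP[z0 zb].
have [t1 t0] : z / b <= 1 /\ 0 <= z / b.
  by rewrite ler_pdivrMr// mul1r zb divr_ge0// ltW.
pose t := Itv01 t0 t1.
have := convex_expR t (s * b) 0.
rewrite !convRE/= expR0 mulr1 mulr0 addr0.
have -> : z / b * (s * b) = s * z by field; rewrite gt_eqF.
by move=> h; apply: le_trans h _; rewrite addrC; exact: lexx.
Qed.

(** Bounding the exponential by its chord over [[0, b]] replaces [h] by a variable on the two points
    0 and [b] with the same mean, so the Bernoulli case with [th = mu / b] and [u = s * b]
    applies. *)
Lemma hoeffding_mgf (R : realType) (T : finType) (w h : T -> R) (b s : R) :
  0 < b -> (forall k, 0 <= w k) -> \sum_k w k = 1 -> (forall k, 0 <= h k <= b) ->
  \sum_k w k * expR (s * (h k - \sum_j w j * h j)) <= expR (s ^+ 2 * b ^+ 2 / 8).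
Proof.
move=> b0 w0 w1 h0b.
set mu := \sum_j w j * h j.
have mu0 : 0 <= mu by apply: sumr_ge0 => k _; rewrite mulr_ge0//; case/andP: (h0b k).
have mub : mu <= b.
  rewrite -[leRHS]mul1r -w1 mulr_suml; apply: ler_sum => k _.
  by have /andP[_ ?] := h0b k; rewrite ler_wpM2l.
apply: (@le_trans _ _ (\sum_k w k * (1 - h k / b + h k / b * expR (s * b)) * expR (- (s * mu)))).
  apply: ler_sum => k _.
  rewrite mulrBr expRD -mulrA ler_wpM2l// ler_wpM2r ?expR_ge0//.
  exact: expR_chord_le.
rewrite -mulr_suml.
have -> : \sum_k w k * (1 - h k / b + h k / b * expR (s * b)) =
          1 - mu / b + mu / b * expR (s * b).
  rewrite (eq_bigr (fun k => w k + w k * h k * ((expR (s * b) - 1) / b))); last first.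
    by move=> k _; ring.
  rewrite big_split/= w1 -mulr_suml -/mu; ring.
have := @bernoulli_mgf_le _ (mu / b) (s * b).
rewrite divr_ge0 ?(ltW b0)//= ler_pdivrMr// mul1r => /(_ mub).
rewrite -(ler_pM2r (expR_gt0 (- (s * mu)))) => H; apply: le_trans H _.
rewrite -expRD ler_expR le_eqVlt; apply/orP; left; apply/eqP; field.
by rewrite gt_eqF.
Qed.

(** Chernoff's method: the indicator of the event is dominated by an exponential, whose sum against
    the product weights factors into [n] equal moment generating functions. *)
Lemma hoeffding_tail (R : realType) (T : finType) (w h : T -> R) (b tau : R) (n : nat) :
  0 < b -> 0 <= tau ->
  (forall k, 0 <= w k) -> \sum_k w k = 1 -> (forall k, 0 <= h k <= b) ->
  \sum_(k : {ffun 'I_n -> T} |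
      n%:R * tau < \sum_(i < n) (h (k i) - \sum_j w j * h j)) \prod_(i < n) w (k i)
    <= expR (- (2 * n%:R * tau ^+ 2 / b ^+ 2)).
Proof.
move=> b0 tau0 w0 w1 h0b; set mu := \sum_j w j * h j.
(* The minimiser of [- s * tau + s^2 * b^2 / 8]. *)
pose s := 4 * tau / b ^+ 2.
have s0 : 0 <= s by apply: divr_ge0; [exact: mulr_ge0 | exact: sqr_ge0].
have bn0 : b != 0 by rewrite gt_eqF.
apply: (@le_trans _ _ (\sum_(k : {ffun 'I_n -> T})
   expR (- (s * (n%:R * tau))) * \prod_(i < n) (w (k i) * expR (s * (h (k i) - mu))))).
  rewrite big_mkcond/=; apply: ler_sum => k _.
  have p0 : 0 <= \prod_(i < n) w (k i) by apply: prodr_ge0.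
  rewrite [X in _ <= _ * X]big_split/= [leRHS]mulrCA; case: ifPn => [big|_]; last first.
    apply: mulr_ge0 => //; apply: mulr_ge0; first exact: expR_ge0.
    by apply: prodr_ge0 => i _; exact: expR_ge0.
  rewrite ler_peMr// -expR_sum -expRD -[leLHS]expR0 ler_expR -mulr_sumr addrC -mulrBr.
  apply: mulr_ge0 => //; by rewrite subr_ge0 ltW.
rewrite -mulr_sumr -(bigA_distr_bigA (fun (_ : 'I_n) k => w k * expR (s * (h k - mu)))).
rewrite prodr_const card_ord.
apply: (@le_trans _ _ (expR (- (s * (n%:R * tau))) * expR (s ^+ 2 * b ^+ 2 / 8) ^+ n)).
  rewrite ler_wpM2l ?expR_ge0// lerXn2r ?nnegrE ?expR_ge0//; last exact: hoeffding_mgf.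
  by apply: sumr_ge0 => k _; rewrite mulr_ge0 ?expR_ge0.
rewrite -expRM_natl -expRD ler_expR le_eqVlt; apply/orP; left; apply/eqP.
by rewrite /s; field.
Qed.

(** The lower tail of [h] is the upper tail of [b - h], which has the same range. *)
Lemma hoeffding_two_sided (R : realType) (T : finType) (w h : T -> R) (b tau : R) (n : nat) :
  (0 < n)%N -> 0 < b -> 0 <= tau ->
  (forall k, 0 <= w k) -> \sum_k w k = 1 -> (forall k, 0 <= h k <= b) ->
  \sum_(k : {ffun 'I_n -> T} |
      tau < `|n%:R^-1 * \sum_(i < n) h (k i) - \sum_j w j * h j|) \prod_(i < n) w (k i)
    <= 2 * expR (- (2 * n%:R * tau ^+ 2 / b ^+ 2)).
Proof.
move=> n0 b0 tau0 w0 w1 h0b; set mu := \sum_j w j * h j.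
have nR0 : 0 < n%:R :> R by rewrite ltr0n.
pose h' k := b - h k.
have mu' : \sum_j w j * h' j = b - mu.
  rewrite /h' (eq_bigr (fun j => w j * b - w j * h j)).
    by rewrite sumrB -mulr_suml w1 mul1r.
  by move=> j _; rewrite mulrBr.
have h'0b k : 0 <= h' k <= b by have := h0b k; rewrite /h'; lra.
have p0 (k : {ffun 'I_n -> T}) : 0 <= \prod_(i < n) w (k i) by apply: prodr_ge0.
have H := lerD (hoeffding_tail n b0 tau0 w0 w1 h0b) (hoeffding_tail n b0 tau0 w0 w1 h'0b).
rewrite [leRHS]mulr_natl mulr2n; apply: le_trans H.
rewrite !(big_mkcond (fun k => _ < _))/= -big_split/=; apply: ler_sum => k _.
have E1 : \sum_(i < n) (h (k i) - mu) = n%:R * (n%:R^-1 * \sum_(i < n) h (k i) - mu).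
  by rewrite sumrB sumr_const card_ord mulrBr mulrA divff ?gt_eqF// mul1r mulr_natl.
have E2 : \sum_(i < n) (h' (k i) - (b - mu)) = n%:R * - (n%:R^-1 * \sum_(i < n) h (k i) - mu).
  rewrite mulrN -E1 -[RHS]sumrN; apply: eq_bigr => i _; rewrite /h'; ring.
rewrite -/mu mu' E1 E2 !ltr_pM2l// ltr_normr.
case: ifP; case: ifP; case: ifP => //=; move=> *; rewrite ?addr0 ?add0r ?lerDl ?addr_ge0//.
Qed.

Lemma uniform_hoeffding (R : realType) (T S : finType) (w : T -> R) (h : S -> T -> R)
    (b tau : R) (n : nat) :
  (0 < n)%N -> 0 < b -> 0 <= tau ->
  (forall k, 0 <= w k) -> \sum_k w k = 1 -> (forall s k, 0 <= h s k <= b) ->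
  \sum_(k : {ffun 'I_n -> T} | [exists s,
      tau < `|n%:R^-1 * \sum_(i < n) h s (k i) - \sum_j w j * h s j|]) \prod_(i < n) w (k i)
    <= #|S|%:R * (2 * expR (- (2 * n%:R * tau ^+ 2 / b ^+ 2))).
Proof.
move=> n0 b0 tau0 w0 w1 h0b.
apply: (@le_trans _ _ (\sum_(s : S) \sum_(k : {ffun 'I_n -> T} |
    tau < `|n%:R^-1 * \sum_(i < n) h s (k i) - \sum_j w j * h s j|) \prod_(i < n) w (k i))).
  under [leRHS]eq_bigr do rewrite big_mkcond/=.
  rewrite exchange_big/= big_mkcond/=; apply: ler_sum => k _.
  have p0 : 0 <= \prod_(i < n) w (k i) by apply: prodr_ge0.
  case: ifPn => [/existsP[s hs]|_]; last by apply: sumr_ge0 => s _; case: ifP.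
  rewrite (bigD1 s)//= hs lerDl; apply: sumr_ge0 => s' _; by case: ifP.
rewrite mulr_natl -sumr_const; apply: ler_sum => s _.
exact: hoeffding_two_sided.
Qed.

(** * Quantisation of random vectors *)

Section finite_valued.
Context (disp : measure_display) (Omega : measurableType disp) (R : realType).
Variables (P : probability Omega R) (T : finType) (k : Omega -> T).
Hypothesis mk : forall t, measurable (k @^-1` [set t]).

Lemma measurable_preimage_finite (B : set T) : measurable (k @^-1` B).
Proof.
have -> : k @^-1` B = \bigcup_(t in B) k @^-1` [set t].
  apply/seteqP; split => w /=; first by move=> Bw; exists (k w).
  by move=> [t Bt /= ->].
by apply: fin_bigcup_measurable => //; exact: finite_finset.
Qed.

Lemma measurable_fun_finite d' (U : measurableType d') (h : T -> U) :
  measurable_fun setT (h \o k).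
Proof. by move=> _ Y mY; rewrite setTI comp_preimage; exact: measurable_preimage_finite. Qed.

Lemma integral_finite_valued (h : T -> R) : (forall t, 0 <= h t) ->
  (\int[P]_v (h (k v))%:E)%E = (\sum_t h t * fine (P (k @^-1` [set t])))%:E.
Proof.
move=> h0.
transitivity (\int[P]_v \sum_t (h t * \1_(k @^-1` [set t]) v)%:E)%E.
  apply: eq_integral => v _; rewrite sumEFin; congr EFin.
  rewrite (bigD1 (k v))//= indicE mem_set// mulr1 big1 ?addr0// => t tk.
  by rewrite indicE memNset ?mulr0//= => kt; rewrite kt eqxx in tk.
rewrite ge0_integral_sum//; last 2 first.
- move=> t; apply/measurable_EFinP; apply: measurable_funM; first exact: measurable_cst.
  exact: measurable_indic.
- by move=> t v _; rewrite lee_fin mulr_ge0.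
rewrite -sumEFin; apply: eq_bigr => t _.
under eq_integral do rewrite EFinM.
rewrite ge0_integralZl ?lee_fin//; last first.
  by apply/measurable_EFinP; exact: measurable_indic.
by rewrite integral_indic// setIT EFinM fineK// fin_num_measure.
Qed.

Lemma probability_finite_valued (B : pred T) :
  P [set w | B (k w)] = (\sum_(t | B t) fine (P (k @^-1` [set t])))%:E.
Proof.
have mB : measurable [set w | B (k w)] by exact: (measurable_preimage_finite [set t | B t]).
have -> : \sum_(t | B t) fine (P (k @^-1` [set t]))
          = \sum_t (B t)%:R * fine (P (k @^-1` [set t])).
  by rewrite big_mkcond/=; apply: eq_bigr => t _; case: (B t); rewrite ?mul1r ?mul0r.
rewrite -integral_finite_valued => [|t]; last exact: ler0n.
rewrite -[in LHS](setIT [set w | B (k w)]) -integral_indic//.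
apply: eq_integral => v _; rewrite indicE; congr ((nat_of_bool _)%:R%:E).
by apply/idP/idP; rewrite inE.
Qed.

End finite_valued.

(** The largest index, [(2 * T + 1) * J + 1], is one more than the index of the point [T], so the
    overflow cell misses [[-T, T]]. *)
Definition quant_size (T J : nat) : nat := (((2 * T).+1 * J).+1).+1.

(* Cells of width [1/J]; the shift by [T + 1] keeps [-T, T] away from the
   truncation of negative numbers to 0, so that the two unbounded cells at the
   ends do not meet [-T, T]. *)
Definition quant (R : realType) (T J : nat) (r : R) : 'I_(quant_size T J) :=
  inord (minn ((2 * T).+1 * J).+1 (Num.truncn ((r + T.+1%:R) * J%:R))).

Section quantizer.
Variables (R : realType) (T J : nat).

Lemma quantE (r : R) : quant T J r =
  minn ((2 * T).+1 * J).+1 (Num.truncn ((r + T.+1%:R) * J%:R)) :> nat.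
Proof. by rewrite inordK// ltnS geq_minl. Qed.

(** [quant] is monotone, so its fibres are intervals. *)
Lemma measurable_quant t : measurable ((@quant R T J) @^-1` [set t]).
Proof.
apply: is_interval_measurable => r s /= rt st u /andP[ru us].
have mono (a b : R) : a <= b -> (quant T J a <= quant T J b)%N.
  move=> ab; rewrite !quantE leq_min geq_minl/=; apply: leq_trans (geq_minr _ _) _.
  by rewrite le_truncn// ler_wpM2r// lerD2r.
apply/val_inj/eqP => /=; rewrite eqn_leq; apply/andP; split.
  by rewrite -[t in leqRHS]st mono.
by rewrite -[t in leqLHS]rt mono.
Qed.

Lemma quant_close (r s : R) : (0 < J)%N -> `|s| <= T%:R ->
  quant T J r = quant T J s -> `|r - s| <= J%:R^-1.
Proof.
move=> J0 sT rs; have JR : 0 < J%:R :> R by rewrite ltr0n.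
pose z u : R := (u + T.+1%:R) * J%:R.
have T1 : T.+1%:R = T%:R + 1 :> R by rewrite -natr1.
have [sl su] : J%:R <= z s /\ z s <= ((2 * T).+1 * J)%:R.
  move: sT; rewrite ler_norml => /andP[s1 s2]; rewrite /z; split.
    by rewrite ler_peMl ?ler0n//; lra.
  by rewrite natrM ler_wpM2r// T1 -natr1 natrM; lra.
have z0 : 0 <= z s by rewrite (le_trans _ sl)// ltW.
have tl : (J <= Num.truncn (z s))%N by rewrite truncn_ge_nat.
have tu : (Num.truncn (z s) <= (2 * T).+1 * J)%N.
  by rewrite truncn_le_nat (le_lt_trans su)// ltr_nat.
(* The cap is inactive at [s], and equality of the indices then makes it inactive at [r] too. *)
have E : Num.truncn (z r) = Num.truncn (z s).
  have := congr1 val rs; rewrite /= !quantE -/(z r) -/(z s).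
  rewrite [in RHS](minn_idPr _); last by rewrite (leq_trans tu).
  case: (leqP ((2 * T).+1 * J).+1 (Num.truncn (z r))) => [_ h|//].
  by move: tu; rewrite -h ltnn.
(* The common index is at least [J >= 1], which excludes the cell collecting the negative
   numbers. *)
have zr0 : 0 <= z r.
  by apply: ltW; apply: (lt_le_trans ltr01); rewrite -truncn_gt0 E (leq_trans J0).
have /andP[a1 a2] := truncn_itv z0; have /andP[b1 b2] := truncn_itv zr0.
rewrite E in b1 b2; rewrite -natr1 in a2 b2.
have zz : `|z r - z s| <= 1 by rewrite ler_norml; lra.
have -> : r - s = (z r - z s) / J%:R by rewrite /z; field; rewrite gt_eqF.
by rewrite normrM normfV (gtr0_norm JR) ler_piMl// invr_ge0 ltW.
Qed.

End quantizer.

Definition vquant (R : realType) (m T J : nat) (v : 'cV[R]_m) :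
    {ffun 'I_m -> 'I_(quant_size T J)} :=
  [ffun j => quant T J (v j 0)].

Section vector_quantizer.
Variables (R : realType) (m : nat).

Lemma vquant_close T J (u v : 'cV[R]_m) : (0 < J)%N -> l2norm v <= T%:R ->
  vquant T J u = vquant T J v -> l2norm (u - v) <= Num.sqrt m%:R / J%:R.
Proof.
move=> J0 vT /ffunP uv; apply: l2norm_le_sqrt => [|j]; first by rewrite invr_ge0.
rewrite !mxE; apply: (@quant_close _ T) => //.
  exact: le_trans (coord_le_l2norm v j) vT.
by have := uv j; rewrite !ffunE.
Qed.

Lemma vquant_fibre (disp : measure_display) (Omega : measurableType disp)
    (y : Omega -> 'cV[R]_m) T J t :
  (fun w => vquant T J (y w)) @^-1` [set t] =
  [set w | forall j, (@quant R T J @^-1` [set t j]) (y w j 0)].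
Proof.
apply/seteqP; split => w /=; first by move=> <- j; rewrite ffunE.
by move=> h; apply/ffunP => j; rewrite ffunE h.
Qed.

Lemma measurable_vquant (disp : measure_display) (Omega : measurableType disp)
    (y : Omega -> 'cV[R]_m) T J t : random_vector y ->
  measurable ((fun w => vquant T J (y w)) @^-1` [set t]).
Proof.
move=> my; rewrite vquant_fibre.
have -> : [set w | forall j, (@quant R T J @^-1` [set t j]) (y w j 0)] =
    \bigcap_(j in [set: 'I_m]) ((fun w => y w j 0) @^-1` (@quant R T J @^-1` [set t j])).
  by apply/seteqP; split => w /= h j; [move=> _; exact: h | exact: (h j I)].
apply: fin_bigcap_measurable => [|j _]; first exact: finite_finset.
rewrite -[X in measurable X]setTI; apply: my => //; exact: measurable_quant.
Qed.

(** An open set is the countable union, over quantisers of growing range [J] and width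
    [1 / (J + 1)], of the cells contained in it. *)
Lemma measurable_open_random_vector (disp : measure_display)
    (Omega : measurableType disp) (y : Omega -> 'cV[R]_m) (U : set 'cV[R]_m) :
  random_vector y ->
  (forall u, U u -> exists2 r : R, 0 < r & forall v, l2norm (v - u) <= r -> U v) ->
  measurable (y @^-1` U).
Proof.
move=> my Uo.
pose B J : set {ffun 'I_m -> 'I_(quant_size J J.+1)} :=
  [set t | forall v : 'cV[R]_m, vquant J J.+1 v = t -> U v].
have -> : y @^-1` U = \bigcup_J ((fun w => vquant J J.+1 (y w)) @^-1` (B J)).
  apply/seteqP; split => w /=; last by move=> [J _]; apply.
  move=> /Uo[r r0 rU].
  (* Large enough both for the range to contain [y w] and for its cell to have diameter within
     [r]. *)
  pose J := (Num.truncn (l2norm (y w)) + Num.truncn (Num.sqrt m%:R / r)).+1.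
  have lt_trunc (z : R) : z <= (Num.truncn z).+1%:R by rewrite ltW// truncnS_gt.
  exists J => // v vq; apply: rU.
  apply: le_trans (vquant_close _ _ vq) _ => //.
    by apply: le_trans (lt_trunc _) _; rewrite ler_nat ltnS leq_addr.
  rewrite ler_pdivrMr ?ltr0n// mulrC -ler_pdivrMr//.
  by apply: le_trans (lt_trunc _) _; rewrite ler_nat ltnS ltnW// ltnS leq_addl.
apply: bigcupT_measurable => J; apply: measurable_preimage_finite => t.
exact: measurable_vquant.
Qed.

(** The one-sided perturbation bound in [x] makes the strict sublevel sets of [fx] open. *)
Lemma measurable_fx (disp : measure_display) (Omega : measurableType disp)
    (y : Omega -> 'cV[R]_m) d p q lam (D : 'M[R]_(m, d)) :
  0 < p -> 0 < q -> random_vector y ->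
  measurable_fun setT (fun w => fx p q lam (y w) D).
Proof.
move=> p0 q0 my mT; apply: (measurability _ (RGenInftyO.measurableE R)) => //.
move=> _ [_ [c ->] <-]; rewrite setTI.
apply: (measurable_open_random_vector (U := (fun u => fx p q lam u D) @^-1` `]-oo, c[)) => // u.
rewrite /= in_itv/= => uc.
pose e := c - fx p q lam u D; have e0 : 0 < e by rewrite subr_gt0.
have N0 := l2norm_ge0 u.
pose r := Num.min 1 (e / (l2norm u + 1)).
have N1 : 0 < l2norm u + 1 by lra.
have r0 : 0 < r by rewrite lt_min ltr01 divr_gt0.
exists r => // v vr; rewrite /= in_itv/=.
have := fx_perturb_x lam p0 q0 D vr.
have r1 : r <= 1 by rewrite ge_min lexx.
have re : r * (l2norm u + 1) <= e by rewrite -ler_pdivlMr// ge_min lexx orbT.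
by move: re; rewrite /e; nra.
Qed.

Lemma measurable_unit_ball (disp : measure_display) (Omega : measurableType disp)
    (y : Omega -> 'cV[R]_m) : random_vector y ->
  measurable [set w | l2norm (y w) <= 1].
Proof.
move=> my; rewrite -[X in measurable X]setCK; apply: measurableC.
have -> : ~` [set w | l2norm (y w) <= 1] = y @^-1` [set u | 1 < l2norm u].
  by apply/seteqP; split => w /=; rewrite ltNge => /negP.
apply: measurable_open_random_vector => // u /= u1.
exists ((l2norm u - 1) / 2) => [|v vr /=]; first by rewrite divr_gt0// subr_gt0.
have : l2norm u <= l2norm v + l2norm (v - u).
  have -> : l2norm (v - u) = l2norm (u - v) by rewrite -l2normN opprB.
  by have := l2normD v (u - v); rewrite addrC subrK.
lra.
Qed.

End vector_quantizer.

(** * Concentration of the quantised sample over a finite family of functions *)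

Section net_concentration.
Context (disp : measure_display) (Omega : measurableType disp) (R : realType).
Variables (P : probability Omega R) (m n T J : nat).
Variables (y : Omega -> 'cV[R]_m) (x : 'I_n -> Omega -> 'cV[R]_m).
Hypotheses (my : random_vector y) (mx : forall i, random_vector (x i)).
Hypotheses (xy : forall i, same_law P (x i) y) (ind : independent_vectors P x).

Local Notation cell := {ffun 'I_m -> 'I_(quant_size T J)}.

Definition cell_prob (t : cell) : R := fine (P ((fun w => vquant T J (y w)) @^-1` [set t])).

Let xcell (w : Omega) : {ffun 'I_n -> cell} := [ffun i => vquant T J (x i w)].

Lemma cell_prob_ge0 t : 0 <= cell_prob t.
Proof. by rewrite fine_ge0. Qed.

Lemma sum_cell_prob : \sum_t cell_prob t = 1.
Proof.
have := probability_finite_valued P (fun t : cell => measurable_vquant t my) xpredT.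
rewrite [X in P X](_ : _ = setT); last by apply/seteqP; split.
by rewrite probability_setT => -[].
Qed.

Lemma xcell_fibre k : xcell @^-1` [set k] =
  [set w | forall i j, (@quant R T J @^-1` [set k i j]) (x i w j 0)].
Proof.
apply/seteqP; split => w /=; first by move=> <- i j; rewrite !ffunE.
by move=> h; apply/ffunP => i; rewrite ffunE; apply/ffunP => j; rewrite ffunE h.
Qed.

Lemma measurable_xcell k : measurable (xcell @^-1` [set k]).
Proof.
have -> : xcell @^-1` [set k] =
    \bigcap_(i in [set: 'I_n]) ((fun w => vquant T J (x i w)) @^-1` [set k i]).
  apply/seteqP; split => w /=; first by move=> <- i _ /=; rewrite ffunE.
  by move=> h; apply/ffunP => i; rewrite ffunE; exact: h.
apply: fin_bigcap_measurable => [|i _]; first exact: finite_finset.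
exact: measurable_vquant.
Qed.

Lemma xcell_prob k : fine (P (xcell @^-1` [set k])) = \prod_(i < n) cell_prob (k i).
Proof.
rewrite xcell_fibre (ind (B := fun i j => @quant R T J @^-1` [set k i j])); last first.
  by move=> i j; exact: measurable_quant.
apply: eq_bigr => i _; rewrite /cell_prob vquant_fibre.
by rewrite (xy i (B := fun j => @quant R T J @^-1` [set k i j]))// => j; exact: measurable_quant.
Qed.

(** The positivity clause stands in for the samples lying in the unit ball. It leaves the failure
    bound unchanged, since a tuple containing a null cell has product weight 0. *)
Lemma net_concentration (S : finType) (h : S -> cell -> R) (b tau : R) :
  (0 < n)%N -> 0 < b -> 0 <= tau -> (forall s t, 0 <= h s t <= b) ->
  exists A : set Omega, [/\ measurable A,
    ((1 - #|S|%:R * (2 * expR (- (2 * n%:R * tau ^+ 2 / b ^+ 2))))%:E <= P A)%E &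
    forall w, A w -> (forall i, 0 < cell_prob (vquant T J (x i w))) /\
      forall s, `|n%:R^-1 * \sum_(i < n) h s (vquant T J (x i w))
                 - \sum_t cell_prob t * h s t| <= tau].
Proof.
move=> n0 b0 tau0 h0b.
pose dev (k : {ffun 'I_n -> cell}) := [exists s,
  tau < `|n%:R^-1 * \sum_(i < n) h s (k i) - \sum_t cell_prob t * h s t|].
pose bad (k : {ffun 'I_n -> cell}) := dev k || [exists i, cell_prob (k i) == 0].
have mbad : measurable [set w | bad (xcell w)].
  exact: (measurable_preimage_finite measurable_xcell [set k | bad k]).
exists (~` [set w | bad (xcell w)]); split.
- exact: measurableC.
- rewrite probability_setC// (probability_finite_valued P measurable_xcell).
  rewrite -EFinB lee_fin lerD2l lerN2.
  under eq_bigr do rewrite xcell_prob.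
  apply: le_trans (uniform_hoeffding n0 b0 tau0 cell_prob_ge0 sum_cell_prob h0b).
  rewrite [leLHS]big_mkcond [leRHS]big_mkcond/=; apply: ler_sum => k _.
  rewrite /bad -/(dev k); case: ifPn => [/orP[-> //|/existsP[i /eqP ki]]|_].
    rewrite (bigD1 i)//= ki mul0r; case: ifP => // _.
  by case: ifP => // _; apply: prodr_ge0 => i _; exact: cell_prob_ge0.
- move=> w /= /negP; rewrite negb_or => /andP[/existsPn ndev /existsPn pos]; split.
    move=> i; have := pos i; rewrite ffunE lt_neqAle eq_sym => ->.
    exact: cell_prob_ge0.
  move=> s; have := ndev s; rewrite -leNgt.
  suff -> : \sum_(i < n) h s (xcell w i) = \sum_(i < n) h s (vquant T J (x i w)) by [].
  by apply: eq_bigr => i _; rewrite ffunE.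
Qed.

End net_concentration.

(** * Deviation over the grid of dictionaries *)

(** [F] is almost surely squeezed between the finite-valued functions [h - e] and [h + e] of [k],
    whose integrals are finite sums; the upper one also shows that the integral of [F] is finite. *)
Lemma integral_approx (disp : measure_display) (Omega : measurableType disp)
    (R : realType) (P : probability Omega R) (T : finType) (k : Omega -> T)
    (F : Omega -> R) (h : T -> R) (e : R) (B : set Omega) :
  (forall t, measurable (k @^-1` [set t])) ->
  (forall v, 0 <= F v) -> measurable_fun setT F -> (forall t, 0 <= h t) -> 0 <= e ->
  measurable B -> P B = 1%E -> (forall v, B v -> `|F v - h (k v)| <= e) ->
  `|fine (\int[P]_v (F v)%:E)%E - \sum_t fine (P (k @^-1` [set t])) * h t| <= e.
Proof.
move=> mk F0 mF h0 e0 mB PB Fh.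
pose w t := fine (P (k @^-1` [set t])).
have w0 t : 0 <= w t by rewrite fine_ge0.
have w1 : \sum_t w t = 1.
  have := probability_finite_valued P mk xpredT.
  rewrite [X in P X](_ : _ = setT); last by apply/seteqP; split.
  by rewrite probability_setT => -[].
have aeB (Q : Omega -> Prop) : (forall v, B v -> Q v) -> {ae P, forall v, [set: Omega] v -> Q v}.
  move=> BQ; exists (~` B); split; first exact: measurableC.
    by rewrite probability_setC// PB subee.
  by move=> v /= nQ Bv; apply: nQ => _; exact: BQ.
(* The lower function is truncated at 0 because the comparison of integrals is made for nonnegative
   functions. *)
pose g t := h t + e; pose l t := Num.max 0 (h t - e).
have g0 t : 0 <= g t by rewrite addr_ge0.
have l0 t : 0 <= l t by rewrite le_max lexx.
have mkh (f : T -> R) : measurable_fun setT (fun v => (f (k v))%:E).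
  by apply/measurable_EFinP; exact: (measurable_fun_finite mk f).
have mFE : measurable_fun setT (fun v => (F v)%:E) by exact/measurable_EFinP.
have up : (\int[P]_v (F v)%:E <= \int[P]_v (g (k v))%:E)%E.
  apply: ae_ge0_le_integral => //.
  - by move=> v _; rewrite lee_fin.
  - by move=> v _; rewrite lee_fin.
  - apply: aeB => v /Fh; rewrite ler_norml lee_fin /g; lra.
have lo : (\int[P]_v (l (k v))%:E <= \int[P]_v (F v)%:E)%E.
  apply: ae_ge0_le_integral => //.
  - by move=> v _; rewrite lee_fin.
  - by move=> v _; rewrite lee_fin.
  - apply: aeB => v /Fh; rewrite ler_norml lee_fin ge_max F0/=; lra.
rewrite integral_finite_valued// in up; rewrite integral_finite_valued// in lo.
have IE : (\int[P]_v (F v)%:E)%E \is a fin_num.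
  by rewrite ge0_fin_numE ?(le_lt_trans up) ?ltry// integral_ge0// => v _; rewrite lee_fin.
rewrite -(fineK IE) !lee_fin in up lo.
have gE : \sum_t g t * w t = \sum_t w t * h t + e.
  rewrite -[X in _ + X]mulr1 -w1 mulr_sumr -big_split/=; apply: eq_bigr => t _.
  by rewrite /g mulrDl mulrC.
have lE : \sum_t w t * h t - e <= \sum_t l t * w t.
  rewrite -[X in _ - X]mulr1 -w1 mulr_sumr -sumrB; apply: ler_sum => t _.
  by rewrite [w t * _]mulrC -mulrBl ler_wpM2r// le_max lexx orbT.
by rewrite gE in up; rewrite ler_norml; lra.
Qed.

(** Midpoints of the [K] equal subintervals of [[-1, 1]], whence the covering radius [1 / K]. *)
Definition grid (R : realType) (K : nat) (k : 'I_K) : R := (2 * k + 1)%:R / K%:R - 1.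

Lemma grid_net (R : realType) (K : nat) (r : R) : (0 < K)%N -> `|r| <= 1 ->
  exists k : 'I_K, `|grid R k - r| <= K%:R^-1.
Proof.
move=> K0 r1; have KR : 0 < K%:R :> R by rewrite ltr0n.
pose z := (r + 1) * K%:R / 2.
have rE : r = 2 * z / K%:R - 1 by rewrite /z; field; rewrite gt_eqF.
move: r1; rewrite ler_norml => /andP[ra rb].
have z0 : 0 <= z by rewrite /z; nra.
have zK : z <= K%:R by rewrite /z; nra.
have [k [ka kb]] : exists k : 'I_K, k%:R <= z /\ z <= k%:R + 1.
  have [zlt|zge] := ltP z K%:R.
    have tK : (Num.truncn z < K)%N by rewrite truncn_lt_nat.
    exists (Ordinal tK) => /=; have /andP[a /ltW b] := truncn_itv z0.
    by rewrite a natr1 b.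
  (* Here [r = 1]: the right endpoint is assigned to the last subinterval. *)
  have tK : (K.-1 < K)%N by rewrite prednK.
  exists (Ordinal tK) => /=.
  by rewrite natr1 prednK// zK; split => //; rewrite (le_trans _ zge)// ler_nat leq_pred.
exists k; rewrite {1}rE /grid natrD natrM.
have -> : (2 * k%:R + 1) / K%:R - 1 - (2 * z / K%:R - 1) = (2 * (k%:R - z) + 1) / K%:R.
  by field; rewrite gt_eqF.
rewrite normrM normfV (gtr0_norm KR) ler_piMl ?invr_ge0 ?(ltW KR)//.
rewrite ler_norml; lra.
Qed.

(** Entries of a unit column lie in [[-1, 1]], so each is rounded separately. The rounded dictionary
    may leave the set of unit-column matrices, which the perturbation bound for [fx] permits. *)
Lemma dict_net (R : realType) (m d K : nat) (D : 'M[R]_(m, d)) : (0 < K)%N ->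
  unit_col_dicts m d D -> exists s : 'M['I_K]_(m, d),
    forall j, l2norm (col j (map_mx (@grid R K) s - D)) <= Num.sqrt m%:R / K%:R.
Proof.
move=> K0 uD.
have /choice[f fP] : forall ij : 'I_m * 'I_d, exists k : 'I_K,
    `|grid R k - D ij.1 ij.2| <= K%:R^-1.
  move=> [i j]; apply: grid_net => //=.
  by have := coord_le_l2norm (col j D) i; rewrite (uD j) mxE.
exists (\matrix_(i, j) f (i, j)) => j; apply: l2norm_le_sqrt => [|i].
  by rewrite invr_ge0.
by rewrite !mxE; exact: (fP (i, j)).
Qed.

Lemma norm_avg_le (R : realType) (n : nat) (a b : 'I_n -> R) e : (0 < n)%N ->
  (forall i, `|a i - b i| <= e) ->
  `|n%:R^-1 * \sum_(i < n) a i - n%:R^-1 * \sum_(i < n) b i| <= e.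
Proof.
move=> n0 ab; have nR : 0 < n%:R :> R by rewrite ltr0n.
rewrite -mulrBr -sumrB normrM ger0_norm ?invr_ge0 ?(ltW nR)// ler_pdivrMl//.
apply: le_trans (ler_norm_sum _ _ _) _.
by rewrite mulr_natl -[n in leRHS]card_ord -sumr_const; exact: ler_sum.
Qed.

(* [0] for a cell that misses the unit ball, so the value is in the ball anyway. *)
Definition cell_rep (R : realType) (m J : nat) (t : {ffun 'I_m -> 'I_(quant_size 1 J)}) :
    'cV[R]_m :=
  xget 0 [set u | l2norm u <= 1 /\ vquant 1 J u = t].

Section deviation.
Context (disp : measure_display) (Omega : measurableType disp) (R : realType).
Variables (P : probability Omega R) (m d n J : nat) (p q lam L : R).
Variables (y : Omega -> 'cV[R]_m) (x : 'I_n -> Omega -> 'cV[R]_m).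
Hypotheses (n0 : (0 < n)%N) (J0 : (0 < J)%N).
Hypotheses (p0 : 0 < p) (q0 : 0 < q) (lam0 : 0 < lam).
Hypothesis (hL : lam * d%:R `^ (Num.max (1 - p^-1) 0) * (2^-1) `^ q^-1 <= L).
Hypotheses (my : random_vector y) (mx : forall i, random_vector (x i)).
Hypothesis (y1 : P [set w | l2norm (y w) <= 1] = 1%E).
Hypotheses (xy : forall i, same_law P (x i) y) (ind : independent_vectors P x).

Local Notation rho := (Num.sqrt m%:R / J%:R : R).
Hypothesis rho1 : rho <= 1.
Local Notation E D := (fine (\int[P]_v (fx p q lam (y v) D)%:E)).

Lemma cell_rep_norm t : l2norm (@cell_rep R m J t) <= 1.
Proof.
by rewrite /cell_rep; case: xgetP => [u -> []//|_]; rewrite l2norm0 ler01.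
Qed.

(** The point [v] shows that the cell meets the ball, so its representative is a genuine point of
    the cell and not the default 0. *)
Lemma cell_rep_close (u v : 'cV[R]_m) : l2norm v <= 1 -> vquant 1 J v = vquant 1 J u ->
  l2norm (u - cell_rep R (vquant 1 J u)) <= rho.
Proof.
move=> v1 vu; apply: (@vquant_close _ _ 1) => //; first exact: cell_rep_norm.
by rewrite /cell_rep; case: xgetP => [w -> []//|] /(_ v)[].
Qed.

(** A cell missing the ball would be contained in a null event. *)
Lemma cell_prob_gt0 t : 0 < cell_prob P (T := 1) (J := J) y t ->
  exists2 v : 'cV[R]_m, l2norm v <= 1 & vquant 1 J v = t.
Proof.
move=> t0; apply: contrapT => nex.
have mB := measurable_unit_ball my.
suff : (P ((fun w => vquant 1 J (y w)) @^-1` [set t]) <= 0)%E.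
  by rewrite measure_le0 => /eqP Pt; move: t0; rewrite /cell_prob Pt ltxx.
have <- : P (~` [set w | l2norm (y w) <= 1]) = 0%E.
  by rewrite probability_setC// y1 subee.
apply: le_measure; rewrite ?inE; [exact: measurable_vquant|exact: measurableC|].
by move=> w /= wt w1; apply: nex; exists (y w).
Qed.

Lemma mean_approx (h : {ffun 'I_m -> 'I_(quant_size 1 J)} -> R) (e : R) (D : 'M[R]_(m, d)) :
  (forall t, 0 <= h t) -> 0 <= e ->
  (forall v, l2norm (y v) <= 1 -> `|fx p q lam (y v) D - h (vquant 1 J (y v))| <= e) ->
  `|E D - \sum_t cell_prob P y t * h t| <= e.
Proof.
move=> h0 e0 he; apply: (integral_approx (B := [set w | l2norm (y w) <= 1])) => //.
- by move=> t; exact: measurable_vquant.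
- by move=> v; exact: fx_ge0.
- exact: measurable_fx.
- exact: measurable_unit_ball.
Qed.

(** Almost surely every sample is within [rho] of the ball, so both averages lie between 0 and
    [(1 + rho)^2 / 2], for all [D] at once. *)
Lemma deviation_le_half : exists A : set Omega, [/\ measurable A, P A = 1%E &
  forall w, A w -> forall D : 'M[R]_(m, d),
    `|FX p q lam (fun i => x i w) D - E D| <= 2^-1 * (1 + rho) ^+ 2].
Proof.
have rho0 : 0 <= rho by rewrite divr_ge0// sqrtr_ge0.
(* With an empty family the failure bound is 0, and only the positivity of the sample cells
   remains. *)
have [A [mA PA Ah]] := @net_concentration _ _ _ P m n 1 J y x my mx xy ind void
  (fun _ _ => 0) 1 0 n0 ltr01 (lexx 0) (fun s => match s with end).
exists A; split => //.
  by apply/eqP; rewrite eq_le probability_le1//; move: PA; rewrite card_void mul0r subr0.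
move=> w /Ah[pos _] D.
have ED : 0 <= E D <= 2^-1.
  (* The range [[0, 1/2]] is the ball of radius [1/4] around the constant [1/4]. *)
  have q4 : 0 <= 4^-1 :> R by lra.
  have := @mean_approx (fun=> 4^-1) 4^-1 D (fun=> q4) q4.
  rewrite -mulr_suml sum_cell_prob// mul1r ler_norml.
  have hyp v : l2norm (y v) <= 1 -> `|fx p q lam (y v) D - 4^-1| <= 4^-1.
    move=> v1; have := fx_le_half lam p0 q0 D v1; have := fx_ge0 p q lam (y v) D.
    by rewrite ler_norml; lra.
  by move=> /(_ hyp); lra.
have FD : 0 <= FX p q lam (fun i => x i w) D <= 2^-1 * (1 + rho) ^+ 2.
  have nR : 0 < n%:R :> R by rewrite ltr0n.
  apply/andP; split.
    by rewrite mulr_ge0 ?invr_ge0 ?(ltW nR)// sumr_ge0// => i _; exact: fx_ge0.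
  rewrite ler_pdivrMl// mulr_natl -[n in leRHS]card_ord -sumr_const.
  apply: ler_sum => i _; apply: le_trans (fx_le_sqr lam p0 q0 _ _) _.
  rewrite ler_pM2l// lerXn2r ?nnegrE ?l2norm_ge0 ?addr_ge0//.
  have [v v1 vx] := cell_prob_gt0 (pos i).
  have := l2normD (cell_rep R (vquant 1 J (x i w))) (x i w - cell_rep R (vquant 1 J (x i w))).
  rewrite addrC subrK => h; apply: le_trans h _.
  by rewrite lerD ?cell_rep_norm//; exact: cell_rep_close vx.
have : 2^-1 <= 2^-1 * (1 + rho) ^+ 2 by rewrite ler_peMr// expr_ge1//; lra.
by rewrite ler_norml; lra.
Qed.

(** The empirical and the true mean are each replaced by their quantised versions on the grid,
    whence the factor 2; these differ by at most [tau]. Hoeffding with range [b = 1/2] gives the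
    exponent [8 * n * tau^2]. *)
Lemma uniform_deviation (K : nat) (tau : R) : (0 < K)%N -> 0 <= tau ->
  let del := L * (Num.sqrt m%:R / K%:R) in
  exists A : set Omega, [/\ measurable A,
    ((1 - (K ^ (m * d))%:R * (2 * expR (- (8 * n%:R * tau ^+ 2))))%:E <= P A)%E &
    forall w, A w -> forall D : 'M[R]_(m, d), unit_col_dicts m d D ->
      `|FX p q lam (fun i => x i w) D - E D| <= 2 * (del + del ^+ 2 / 2 + 3 * rho) + tau].
Proof.
move=> K0 tau0 del.
have L0 : 0 <= L by apply: le_trans hL; rewrite !mulr_ge0 ?powR_ge0 ?ltW.
have e0 : 0 <= Num.sqrt m%:R / K%:R :> R by rewrite divr_ge0// sqrtr_ge0.
have del0 : 0 <= del by rewrite mulr_ge0.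
have rho0 : 0 <= rho by rewrite divr_ge0// sqrtr_ge0.
pose h (s : 'M['I_K]_(m, d)) (t : {ffun 'I_m -> 'I_(quant_size 1 J)}) : R :=
  fx p q lam (cell_rep R t) (map_mx (@grid R K) s).
have h0b s t : 0 <= h s t <= 2^-1.
  by rewrite fx_ge0 fx_le_half// cell_rep_norm.
have half0 : 0 < 2^-1 :> R by lra.
have [A [mA PA Ah]] := net_concentration my mx xy ind n0 half0 tau0 h0b.
exists A; split => //.
  move: PA; rewrite card_mx card_ord; congr (_ <= _)%E; congr (1 - _ * (2 * expR (- _)))%:E.
  by field.
move=> w /Ah[pos dev] D uD.
have [s sD] := dict_net K0 uD.
pose e := del + del ^+ 2 / 2 + 3 * rho.
have ee0 : 0 <= e by rewrite !addr_ge0 ?mulr_ge0// sqr_ge0.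
(* First [u] moves to its cell representative, costing [3 * rho]; then [D] moves to the grid,
   costing [del + del^2 / 2]. *)
have approx (u v : 'cV[R]_m) : l2norm v <= 1 -> vquant 1 J v = vquant 1 J u ->
    `|fx p q lam u D - h s (vquant 1 J u)| <= e.
  move=> v1 vu; set c := cell_rep R (vquant 1 J u).
  have c1 : l2norm c <= 1 by exact: cell_rep_norm.
  have h1 := fx_perturb_x_ball lam p0 q0 D c1 (cell_rep_close v1 vu) rho1.
  have h2 := fx_perturb_dict_abs p0 q0 lam0 c1 hL sD e0.
  have -> : fx p q lam u D - h s (vquant 1 J u)
    = (fx p q lam u D - fx p q lam c D) - (h s (vquant 1 J u) - fx p q lam c D) by ring.
  apply: le_trans (ler_normB _ _) _; rewrite /e addrC.
  exact: lerD.
have i1 : `|FX p q lam (fun i => x i w) D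
            - n%:R^-1 * \sum_(i < n) h s (vquant 1 J (x i w))| <= e.
  apply: norm_avg_le => // i; have [v v1 vx] := cell_prob_gt0 (pos i).
  exact: approx vx.
have i2 : `|E D - \sum_t cell_prob P y t * h s t| <= e.
  apply: mean_approx => // [t|v v1]; first by case/andP: (h0b s t).
  exact: approx v1 _.
have i3 := dev s.
move: i1 i2 i3; rewrite -/e !ler_norml; lra.
Qed.

End deviation.

(** * Choice of the grid size *)

Lemma sqrtrD_le (R : realType) (a b : R) : 0 <= a -> 0 <= b ->
  Num.sqrt (a + b) <= Num.sqrt a + Num.sqrt b.
Proof.
move=> a0 b0.
have sa := sqrtr_ge0 a; have sb := sqrtr_ge0 b.
rewrite -ler_sqr ?nnegrE ?sqrtr_ge0 ?addr_ge0// sqrrD !sqr_sqrtr ?addr_ge0//.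
rewrite lerD2r lerDl mulrn_wge0// mulr_ge0//.
Qed.

(** From [expR (- 1/2) >= 1/2] one gets [expR (1/2) <= 2 <= n]. *)
Lemma ln_nat_ge_half (R : realType) (n : nat) : (1 < n)%N -> 2^-1 <= ln n%:R :> R.
Proof.
move=> n1; have n0 : (n%:R : R) \is Num.pos by rewrite posrE ltr0n ltnW.
rewrite -ler_expR lnK//; apply: (@le_trans _ _ 2); last by rewrite ler_nat.
have h := expR_ge1Dx (- 2^-1 : R).
have e := expRxMexpNx_1 (2^-1 : R).
have := expR_gt0 (2^-1 : R); nra.
Qed.

Lemma sqrt8_bounds (R : realType) : 14 / 5 <= Num.sqrt (8 : R) <= 20 / 7.
Proof.
have s0 := sqrtr_ge0 (8 : R); have s2 : Num.sqrt 8 ^+ 2 = 8 :> R by rewrite sqr_sqrtr.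
apply/andP; split; nra.
Qed.

Section sample_size_arithmetic.
Variables (R : realType) (m d n : nat) (t L : R).
Hypotheses (m0 : (0 < m)%N) (d0 : (0 < d)%N) (n0 : (0 < n)%N) (L0 : 0 < L) (t0 : 0 <= t).

Let M : R := Num.max (ln (6 * Num.sqrt 8 * L)) 1.
Let beta : R := (m * d)%:R / 8 * M.
Let eta : R := 2 * Num.sqrt (beta * ln n%:R / n%:R)
             + Num.sqrt ((beta + t / Num.sqrt 8) / n%:R).

Let M1 : 1 <= M. Proof. by rewrite le_max lexx orbT. Qed.

Let nR : 0 < n%:R :> R. Proof. by rewrite ltr0n. Qed.

Let s8 : 0 < Num.sqrt 8 :> R. Proof. by rewrite sqrtr_gt0. Qed.

Lemma beta_ge : (m * d)%:R / 8 <= beta.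
Proof. by rewrite ler_peMr// divr_ge0. Qed.

(** The logarithmic term vanishes, and [beta + t / sqrt 8] is at least [1/8 + 7/40 = 3/10], which
    exceeds [(27/50)^2]. *)
Lemma eta_single : n = 1%N -> 2^-1 <= t -> 27 / 50 <= eta.
Proof.
move=> n1 t1; rewrite /eta n1 ln1 mulr0 mul0r sqrtr0 mulr0 add0r divr1.
have b8 : 1 / 8 <= beta.
  by apply: le_trans beta_ge; rewrite ler_pM2r// ler1n muln_gt0 m0.
have /andP[_ s8u] := sqrt8_bounds R.
have ts : 7 / 40 <= t / Num.sqrt 8 by rewrite ler_pdivlMr//; nra.
rewrite -[leLHS]ger0_norm -?sqrtr_sqr; last by lra.
by rewrite ler_wsqrtr//; lra.
Qed.

(** Since [expR M >= 6 * sqrt 8 * L], the grid is fine enough for [del_le], while [K ^ (m * d)]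
    stays below [expR (m * d * (M + ln n))]. *)
Let K : nat := Num.truncn (expR M * n%:R).
Let del : R := L * (Num.sqrt m%:R / K%:R).
(** Chosen so that [8 * n * tau^2] pays for the logarithm of that cardinality bound and leaves
    exactly [t]. *)
Let tau : R := Num.sqrt (((m * d)%:R * (M + ln n%:R) + t) / (8 * n%:R)).

Lemma K_bounds : [/\ (0 < K)%N, K%:R <= expR M * n%:R & expR M * n%:R <= 2 * K%:R].
Proof.
have e1 : 1 <= expR M * n%:R.
  have eM : 1 <= expR M by rewrite -[leLHS]expR0 ler_expR (le_trans ler01 M1).
  by rewrite mulr_ege1 ?ler1n.
have K0 : (0 < K)%N by rewrite truncn_gt0.
have z0 : 0 <= expR M * n%:R by lra.
have /andP[a b] := truncn_itv z0; split => //.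
have : 1 <= K%:R :> R by rewrite ler1n.
by rewrite -natr1 in b; rewrite /K in a b *; lra.
Qed.

Lemma tau_sqr : tau ^+ 2 = ((m * d)%:R * (M + ln n%:R) + t) / (8 * n%:R).
Proof.
have M0 : 0 <= M := le_trans ler01 M1.
by rewrite sqr_sqrtr// divr_ge0 ?mulr_ge0// addr_ge0// mulr_ge0// addr_ge0// ln_ge0// ler1n.
Qed.

Lemma net_failure_le : (K ^ (m * d))%:R * (2 * expR (- (8 * n%:R * tau ^+ 2))) <= 2 * expR (- t).
Proof.
have [K0 Ku _] := K_bounds.
rewrite tau_sqr mulrCA ler_pM2l//.
rewrite [X in expR (- X)](_ : _ = (m * d)%:R * (M + ln n%:R) + t); last first.
  by field; rewrite gt_eqF.
rewrite opprD expRD mulrA ler_piMl ?expR_ge0// expRN ler_pdivrMr ?expR_gt0// mul1r.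
rewrite expRM_natl natrX lerXn2r ?nnegrE ?expR_ge0//.
by rewrite expRD lnK// posrE.
Qed.

(** [tau^2] is [(m d / 8) * ln n / n + (beta + t / 8) / n]; each summand is enlarged, and the square
    root is subadditive. *)
Lemma tau_le : tau <= Num.sqrt (beta * ln n%:R / n%:R)
                      + Num.sqrt ((beta + t / Num.sqrt 8) / n%:R).
Proof.
have ln0 : 0 <= ln n%:R :> R by rewrite ln_ge0// ler1n.
have b0 : 0 <= beta by apply: le_trans beta_ge; rewrite divr_ge0.
apply: le_trans (sqrtrD_le _ _).
- rewrite ler_wsqrtr// -mulrDl invfM mulrA ler_pM2r ?invr_gt0//.
  have : ln n%:R * ((m * d)%:R / 8) <= ln n%:R * beta by rewrite ler_wpM2l// beta_ge.
  have : t / 8 <= t / Num.sqrt 8.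
    rewrite ler_wpM2l// lef_pV2 ?posrE//; have := sqrt8_bounds R; lra.
  rewrite /beta; lra.
- by apply: divr_ge0 => //; exact: mulr_ge0.
- by apply: divr_ge0 => //; apply: addr_ge0 => //; exact: divr_ge0.
Qed.

Lemma del_gt0 : 0 < del.
Proof.
have [K0 _ _] := K_bounds.
by rewrite mulr_gt0// divr_gt0 ?ltr0n// sqrtr_gt0 ltr0n.
Qed.

(** As [K >= 3 * sqrt 8 * L * n], the square of [3 * del] is at most [m / (8 * n^2)]. Then [n > 1]
    enters twice, through [1 / n <= 1/2] and [1/2 <= ln n]. *)
Lemma del_le : (1 < n)%N -> 3 * del <= Num.sqrt (beta * ln n%:R / n%:R).
Proof.
move=> n1; have [K0 _ Kl] := K_bounds.
have KR : 0 < K%:R :> R by rewrite ltr0n.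
have n2 : 2 <= n%:R :> R by rewrite ler_nat.
have LM : 6 * Num.sqrt 8 * L <= expR M.
  rewrite -[leLHS]lnK; last by rewrite posrE !mulr_gt0.
  by rewrite ler_expR le_max lexx.
have LK : 3 * Num.sqrt 8 * L * n%:R <= K%:R.
  by have := ler_wpM2r (ltW nR) LM; lra.
have mR : 0 <= m%:R :> R by [].
have d3 : 0 <= 3 * del by have := del_gt0; lra.
rewrite -(ger0_norm d3) -sqrtr_sqr ler_wsqrtr//.
have -> : (3 * del) ^+ 2 = (3 * L) ^+ 2 * m%:R / K%:R ^+ 2.
  rewrite /del -[in RHS](sqr_sqrtr mR); move: (Num.sqrt _) => s; field; by rewrite gt_eqF.
apply: (@le_trans _ _ (m%:R / (8 * n%:R ^+ 2))).
  rewrite ler_pdivrMr ?exprn_gt0// [leRHS]mulrAC ler_pdivlMr ?mulr_gt0 ?exprn_gt0//.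
  rewrite [leLHS](_ : _ = m%:R * (3 * Num.sqrt 8 * L * n%:R) ^+ 2).
    by rewrite ler_wpM2l// lerXn2r ?nnegrE ?mulr_ge0// ?ltW.
  have : Num.sqrt 8 ^+ 2 = 8 :> R by rewrite sqr_sqrtr.
  move: (Num.sqrt 8) => s <-; ring.
have lnh := ln_nat_ge_half R n1.
have mb : m%:R / 8 <= beta.
  by apply: le_trans beta_ge; rewrite ler_pM2r// ler_nat leq_pmulr.
apply: (@le_trans _ _ (m%:R / 8 * 2^-1 / n%:R)).
  rewrite ler_pdivlMr// mulrC -[X in X <= _](_ : m%:R / 8 / n%:R = _); last first.
    by field; rewrite gt_eqF.
  by rewrite ler_wpM2l ?divr_ge0// lef_pV2// posrE.
rewrite ler_pM2r ?invr_gt0// ler_pM//; by rewrite divr_ge0.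
Qed.

End sample_size_arithmetic.

(** * Assembly: the regimes of [t] and [eta] *)

Theorem theorem1 (R : realType) (m d n : nat) (p q lam t L : R)
    (disp : measure_display) (Omega : measurableType disp)
    (P : probability Omega R)
    (y : Omega -> 'cV[R]_m) (x : 'I_n -> Omega -> 'cV[R]_m) :
  (0 < m)%N -> (0 < d)%N -> (0 < n)%N ->
  0 < p -> 0 < q -> 0 < lam -> 0 <= t ->
  lam * powR d%:R (Num.max (1 - p^-1) 0) * powR (2^-1) q^-1 < L ->
  (* y ~ the distribution, supported in the closed unit ball *)
  random_vector y ->
  P [set w | l2norm (y w) <= 1] = 1%E ->
  (* x_1, ..., x_n i.i.d. with the same distribution as y *)
  (forall i, random_vector (x i)) ->
  (forall i, same_law P (x i) y) ->
  independent_vectors P x ->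
  let beta := (m * d)%:R / 8 * Num.max (ln (6 * Num.sqrt 8 * L)) 1 in
  let eta := 2 * Num.sqrt (beta * ln n%:R / n%:R)
             + Num.sqrt ((beta + t / Num.sqrt 8) / n%:R) in
  exists A : set Omega, measurable A /\
    ((1 - 2 * expR (- t))%:E <= P A)%E /\
    (forall w, A w ->
       forall D : 'M[R]_(m, d), unit_col_dicts m d D ->
         `| FX p q lam (fun i => x i w) D
            - fine (\int[P]_v (fx p q lam (y v) D)%:E) | <= eta).
Proof.
move=> m0 d0 n0 p0 q0 lam0 t0 hL my y1 mx xy ind beta eta.
have L0 : 0 < L by apply: le_lt_trans hL; rewrite !mulr_ge0 ?powR_ge0 ?ltW.
have sm0 : 0 < Num.sqrt m%:R :> R by rewrite sqrtr_gt0 ltr0n.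
have resolution (e : R) : 0 < e -> exists2 J, (0 < J)%N & Num.sqrt m%:R / J%:R <= e.
  move=> e0; exists (Num.truncn (Num.sqrt m%:R / e)).+1 => //.
  by rewrite ler_pdivrMr ?ltr0n// mulrC -ler_pdivrMr// ltW// truncnS_gt.
(* For [t < 1/2], [expR (- t) >= 1 - t > 1/2] makes the required probability negative, so the empty
   event suffices. *)
have [t1|t1] := ltP t 2^-1.
  exists set0; split; first exact: measurable0; split => [|w []].
  by rewrite measure0 lee_fin; have := expR_ge1Dx (- t); lra.
(* With [rho <= 1/100], the range bound [(1 + rho)^2 / 2] is below [27/50]. *)
have [eta_big|eta_small] := leP (27 / 50) eta.
  have [|J J0 Je] := resolution 100^-1; first by lra.
  have [A [mA PA Ah]] := deviation_le_half d lam n0 J0 p0 q0 my mx y1 xy ind.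
  exists A; split => //; split => [|w Aw D _].
    by rewrite PA lee_fin; have := expR_ge0 (- t); lra.
  apply: le_trans (Ah w Aw D) _; apply: le_trans eta_big.
  have : 0 <= Num.sqrt m%:R / J%:R :> R by rewrite divr_ge0// sqrtr_ge0.
  by move: Je; nra.
have n1 : (1 < n)%N.
  rewrite ltn_neqAle n0 andbT eq_sym; apply/eqP => n1.
  by move: eta_small; rewrite ltNge => /negP; apply; exact: eta_single.
pose M : R := Num.max (ln (6 * Num.sqrt 8 * L)) 1.
pose K := Num.truncn (expR M * n%:R).
have K0 : (0 < K)%N by case: (K_bounds L n0).
pose del := L * (Num.sqrt m%:R / K%:R).
pose tau := Num.sqrt (((m * d)%:R * (M + ln n%:R) + t) / (8 * n%:R)).
have delp : 0 < del by exact: del_gt0.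
have dels : 3 * del <= Num.sqrt (beta * ln n%:R / n%:R) by exact: del_le.
have taus : tau <= Num.sqrt (beta * ln n%:R / n%:R)
                   + Num.sqrt ((beta + t / Num.sqrt 8) / n%:R) by exact: tau_le.
(* [3 * del] is at most half of [eta], hence below [27/100]. *)
have del1 : del <= 1 / 10.
  by move: eta_small dels; rewrite /eta; have := sqrtr_ge0 ((beta + t / Num.sqrt 8) / n%:R); lra.
have [|J J0 Je] := resolution (del / 10); first by lra.
have rho1 : Num.sqrt m%:R / J%:R <= 1 :> R by lra.
have [A [mA PA Ah]] := uniform_deviation n0 J0 p0 q0 lam0 (ltW hL) my mx y1 xy ind rho1
  K0 (sqrtr_ge0 _ : 0 <= tau).
exists A; split => //; split.
  apply: le_trans PA; rewrite lee_fin lerD2l lerN2; exact: net_failure_le.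
move=> w Aw D uD; apply: le_trans (Ah w Aw D uD) _; rewrite -/del /eta.
(* With [rho <= del / 10] and [del <= 1 / 10], the error [2 * del + del^2 + 6 * rho] is at most
   [27/10 * del]. So [3 * del] fits under one of the two copies of the logarithmic square root in
   [eta], and [tau] under the other copy plus the last term. *)
by move: (Num.sqrt m%:R / J%:R) Je => rho Je; nra.
Qed.
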